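(* If an infinite dimensional weak-net-stable Banach space $X$ has property $(sM)$, then $\bar{\delta}_X=\bar{\rho}_X$. In particular, every infinite dimensional net-stable Banach space $X$ with property $(sM)$ satisfies $\bar{\delta}_X=\bar{\rho}_X$.
   Context: The scalar field is $\mathbb{R}$ or $\mathbb{C}$; $S_X$ is the unit sphere of $X$. $X$ has property $(sM)$ if whenever $x,y\in X$ satisfy $\|y\|\le\|x\|$, then $\limsup_\alpha\|y+x_\alpha\|\le\limsup_\alpha\|x+x_\alpha\|$ for every bounded weakly null net $(x_\alpha)\subset X$. $X$ is net-stable (respectively weak-net-stable) if for any pair of bounded (respectively bounded weakly null) nets $(x_\alpha)$ and $(y_\beta)$ in $X$ one has $\lim_\alpha\lim_\beta\|x_\alpha+y_\beta\|=\lim_\beta\lim_\alpha\|x_\alpha+y_\beta\|$ whenever both sides exist. The moduli of asymptotic uniform convexity and smoothness are the functions on $[0,\infty)$ given by $\bar{\delta}_X(t)=\inf_{x\in S_X}\bar{\delta}_X(x,t)$ with $\bar{\delta}_X(x,t)=\sup_{\dim(X/Y)<\infty}\inf_{y\in Y,\|y\|\ge t}\|x+y\|-1$, and $\bar{\rho}_X(t)=\sup_{x\in S_X}\bar{\rho}_X(x,t)$ with $\bar{\rho}_X(x,t)=\inf_{\dim(X/Y)<\infty}\sup_{y\in Y,\|y\|\le t}\|x+y\|-1$, where $Y$ ranges over the closed subspaces of $X$ of finite codimension. *)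

(* Defs.v *)
From HB Require Import structures.
From mathcomp Require Import all_boot all_order all_algebra.
From mathcomp Require Import complex.
From mathcomp Require Import all_classical all_reals all_analysis.

Set Implicit Arguments.
Unset Strict Implicit.
Unset Printing Implicit Defensive.

Import Order.TTheory GRing.Theory Num.Theory.
Import numFieldNormedType.Exports.

Local Open Scope classical_set_scope.
Local Open Scope ring_scope.

Variant scalar_kind := RealScalars | ComplexScalars.

Definition scalars (R : realType) (k : scalar_kind) : numFieldType :=
  match k with RealScalars => R | ComplexScalars => R[i] end.

Definition scalar_re (R : realType) (k : scalar_kind) : scalars R k -> R :=
  match k return scalars R k -> R with
  | RealScalars => fun z => z
  | ComplexScalars => fun z => complex.Re z
  end.

(* In a normedModType K the norm takes its values in K; for K = R[i] these are
   nonnegative complex numbers, so taking real parts loses nothing. *)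
Definition rnorm (R : realType) (k : scalar_kind)
    (X : normedModType (scalars R k)) (x : X) : R :=
  scalar_re (`|x| : scalars R k).

Record directedSet := DirectedSet {
  dir_sort :> Type;
  dir_le : dir_sort -> dir_sort -> Prop;
  dir_refl : forall a, dir_le a a;
  dir_trans : forall a b c, dir_le a b -> dir_le b c -> dir_le a c;
  dir_inh : exists a : dir_sort, True;
  dir_ub : forall a b, exists c, dir_le a c /\ dir_le b c
}.

(* A net x : D -> T converges to l when x @ tails D --> l. *)
Definition tails (D : directedSet) : set_system D :=
  filter_from [set: D] (fun a => [set b | dir_le a b]).
Arguments tails D : clear implicits.

Definition net_limsup (R : realType) (D : directedSet) (f : D -> R) : \bar R :=
  ereal_inf [set ereal_sup [set (f b)%:E | b in [set b | dir_le a b]]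
            | a in [set: D]].

Section Defs.
Variables (R : realType) (k : scalar_kind).
Notation K := (scalars R k).
Variable X : normedModType K.

Definition bounded_net (D : directedSet) (x : D -> X) : Prop :=
  exists M : R, forall a, rnorm (x a) <= M.

Definition weakly_null (D : directedSet) (x : D -> X) : Prop :=
  forall f : {linear X -> K^o}, continuous f -> f \o x @ tails D --> (0 : K^o).

Definition property_sM : Prop :=
  forall x y : X, rnorm y <= rnorm x ->
  forall (D : directedSet) (z : D -> X), bounded_net z -> weakly_null z ->
  (net_limsup (fun a => rnorm (y + z a)%R) <=
   net_limsup (fun a => rnorm (x + z a)%R))%E.

(* lim_a lim_b F a b exists and equals l *)
Definition iterated_lim (A B : directedSet) (F : A -> B -> R) (l : R) : Prop :=
  exists g : A -> R,
    (forall a, F a @ tails B --> g a) /\ g @ tails A --> l.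

Definition limits_commute (A B : directedSet) (x : A -> X) (y : B -> X) : Prop :=
  forall l m : R,
    iterated_lim (fun a b => rnorm (x a + y b)) l ->
    iterated_lim (fun b a => rnorm (x a + y b)) m ->
    l = m.

Definition net_stable : Prop :=
  forall (A B : directedSet) (x : A -> X) (y : B -> X),
    bounded_net x -> bounded_net y -> limits_commute x y.

Definition weak_net_stable : Prop :=
  forall (A B : directedSet) (x : A -> X) (y : B -> X),
    bounded_net x -> weakly_null x -> bounded_net y -> weakly_null y ->
    limits_commute x y.

Definition linear_subspace (Y : set X) : Prop :=
  Y 0 /\ forall (c : K) (u v : X), Y u -> Y v -> Y (c *: u + v).

(* the cosets of finitely many vectors span X / Y *)
Definition finite_codim (Y : set X) : Prop :=
  exists (n : nat) (v : 'I_n -> X),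
    forall x : X, exists c : 'I_n -> K, Y (x - \sum_(i < n) c i *: v i).

Definition infinite_dimensional : Prop :=
  ~ exists (n : nat) (v : 'I_n -> X),
      forall x : X, exists c : 'I_n -> K, x = \sum_(i < n) c i *: v i.

Definition cofinite_subspaces : set (set X) :=
  [set Y | [/\ linear_subspace Y, closed Y & finite_codim Y]].

Definition auc_modulus_at (x : X) (t : R) : \bar R :=
  (ereal_sup [set ereal_inf [set (rnorm (x + y))%:E | y in Y `&` [set y | t <= rnorm y]%R]
             | Y in cofinite_subspaces] - 1)%E.

Definition aus_modulus_at (x : X) (t : R) : \bar R :=
  (ereal_inf [set ereal_sup [set (rnorm (x + y))%:E | y in Y `&` [set y | rnorm y <= t]%R]
             | Y in cofinite_subspaces] - 1)%E.

Definition unit_sphere : set X := [set x | rnorm x = 1].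

Definition auc_modulus (t : R) : \bar R :=
  ereal_inf [set auc_modulus_at x t | x in unit_sphere].

Definition aus_modulus (t : R) : \bar R :=
  ereal_sup [set aus_modulus_at x t | x in unit_sphere].

End Defs.

Arguments property_sM {R k} X.
Arguments net_stable {R k} X.
Arguments weak_net_stable {R k} X.
Arguments infinite_dimensional {R k} X.
Arguments auc_modulus {R k} X t.
Arguments aus_modulus {R k} X t.

(* Main.v *)
Require Import Defs.
From mathcomp Require Import all_boot all_order all_algebra.
From mathcomp Require Import complex.
From mathcomp Require Import all_classical all_reals all_analysis.
From mathcomp Require Import lra.

Import Order.TTheory GRing.Theory Num.Theory.
Import numFieldNormedType.Exports.

Local Open Scope ring_scope.

(** Call an ultrafilter on X asymptotic if it contains every closed subspace of
finite codimension. The kernel of a continuous functional is such a subspace,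
so a bounded asymptotic ultrafilter V, viewed as a net, is weakly null, and
being a bounded ultrafilter it makes every limit of ||x + y|| along y -> V
exist. Property (sM) says that this limit depends only on ||x||
([sM_limit_eq]).

Let V live on the sphere of radius t and W on the sphere of radius s. For w in
the sphere of radius s, the limit of ||w + y|| along V does not depend on w; for
y in the sphere of radius t, the limit of ||w + y|| along W does not depend on
y. Hence both iterated limits of ||w + y|| exist for the pair (W, V), and weak
net stability equates them ([sphere_limits_eq]). Fixing W on the unit sphere and
varying V and the unit vector x yields a single number N = N(t) with
||x + y|| -> N along every asymptotic ultrafilter V on the sphere of radius t
([common_limit]). Infinite dimension provides such V and W, as every finite
codimensional subspace then meets every sphere.

Both moduli at t equal N - 1, at every unit vector x. If one chooses in each
finite codimensional subspace a vector of norm exactly t, then the chosen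
vectors carry an asymptotic ultrafilter, so a uniform bound on ||x + y|| passes
to N. It remains to reduce the conditions ||y|| >= t and ||y|| <= t of the
moduli to ||y|| = t. This is done by radial rescaling: s |-> ||x + s y|| is
convex with value 1 at s = 0, so that a bound c >= 1 survives shrinking y when
it is an upper bound, and stretching y when it is a lower one. That only c >= 1
matters is weak lower semicontinuity of the norm, which follows here from (sM)
without the Hahn-Banach theorem: x and -x have the same norm, so ||x + y|| and
||-x + y|| have the same limit, and their mean is at least ||x||
([rnorm_le_limit]). *)

(** * The real-valued norm *)
Section RealNorm.
Local Open Scope classical_set_scope.
Set Implicit Arguments.
Unset Strict Implicit.
Variables (R : realType) (k : scalar_kind).
Local Notation K := (scalars R k).

Definition real_scalar : R -> K :=
  match k return R -> scalars R k with
  | RealScalars => fun s => s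
  | ComplexScalars => fun s => real_complex R s
  end.

Lemma real_scalar_le a b : (real_scalar a <= real_scalar b) = (a <= b).
Proof. by rewrite /real_scalar; case: k => //; exact: lecR. Qed.

Lemma real_scalarD a b : real_scalar (a + b) = real_scalar a + real_scalar b.
Proof. by rewrite /real_scalar; case: k => //; exact: rmorphD. Qed.

Lemma real_scalarM a b : real_scalar (a * b) = real_scalar a * real_scalar b.
Proof. by rewrite /real_scalar; case: k => //; exact: rmorphM. Qed.

Lemma real_scalar0 : real_scalar 0 = 0.
Proof. by rewrite /real_scalar; case: k. Qed.

Lemma real_scalar1 : real_scalar 1 = 1.
Proof. by rewrite /real_scalar; case: k. Qed.

Lemma real_scalar_inj : injective real_scalar.
Proof. by move=> a b ab; apply/le_anti; rewrite -!real_scalar_le ab lexx. Qed.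

Variable X : normedModType K.
Implicit Types x y : X.

(** Carries the norm axioms, which hold in K, over to the real-valued norm; the
point is that a nonnegative complex number equals its real part. *)
Lemma real_scalar_rnorm x : real_scalar (rnorm x) = `|x|.
Proof.
rewrite /rnorm; have : (`|x| : K) \is Num.real by rewrite ger0_real.
move: (`|x| : K); rewrite /real_scalar /scalar_re; clear X x.
by case: k => //= z /RRe_real.
Qed.

Lemma rnormD x y : rnorm (x + y) <= rnorm x + rnorm y.
Proof. by rewrite -real_scalar_le real_scalarD !real_scalar_rnorm ler_normD. Qed.

Lemma rnorm_ge0 x : 0 <= rnorm x.
Proof. by rewrite -real_scalar_le real_scalar0 real_scalar_rnorm normr_ge0. Qed.

Lemma rnormN x : rnorm (- x) = rnorm x.
Proof. by apply: real_scalar_inj; rewrite !real_scalar_rnorm normrN. Qed.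

Lemma rnorm0_eq0 x : rnorm x = 0 -> x = 0.
Proof. by move=> x0; apply/normr0_eq0; rewrite -real_scalar_rnorm x0 real_scalar0. Qed.

Lemma rnormZ s x : 0 <= s -> rnorm (real_scalar s *: x) = s * rnorm x.
Proof.
move=> s0; apply: real_scalar_inj.
rewrite real_scalarM !real_scalar_rnorm normrZ ger0_norm //.
by rewrite -real_scalar0 real_scalar_le.
Qed.

Lemma rnorm_convex x y s : 0 <= s <= 1 ->
  rnorm (x + real_scalar s *: y) <= (1 - s) * rnorm x + s * rnorm (x + y).
Proof.
move=> /andP[s0 s1]; rewrite -!rnormZ ?subr_ge0 //.
apply: le_trans (rnormD _ _); rewrite scalerDr addrA -scalerDl -real_scalarD.
by rewrite subrK real_scalar1 scale1r.
Qed.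

(** Used along a net on which the two norms on the right have the same limit, which
is then at least ||x||. *)
Lemma le_midpoint x y : rnorm x *+ 2 <= rnorm (x + y) + rnorm (- x + y).
Proof.
rewrite -(rnormN (- x + y)); apply: le_trans (rnormD _ _).
rewrite opprD opprK addrACA subrr addr0.
rewrite (_ : x + x = real_scalar 2 *: x) ?rnormZ ?mulr_natl //.
by rewrite -[2]/(1 + 1) real_scalarD real_scalar1 scalerDl scale1r.
Qed.

End RealNorm.

(** * Closed subspaces of finite codimension *)
Section Cofinite.
Local Open Scope classical_set_scope.
Set Implicit Arguments.
Unset Strict Implicit.
Variables (R : realType) (k : scalar_kind).
Local Notation K := (scalars R k).
Variable X : normedModType K.
Implicit Types (Y Z : set X) (x y v : X).

Lemma subspaceZ Y c x : linear_subspace Y -> Y x -> Y (c *: x).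
Proof. by move=> [Y0 Y1] Yx; rewrite -[_ *: _]addr0; apply: Y1. Qed.

Lemma subspaceI Y Z :
  linear_subspace Y -> linear_subspace Z -> linear_subspace (Y `&` Z).
Proof.
by move=> [Y0 Y1] [Z0 Z1]; split=> // c u v [? ?] [? ?]; split; [apply: Y1|apply: Z1].
Qed.

Definition extend_by Y v : set X := [set x | exists c : K, Y (x - c *: v)].

Lemma subspace_extend_by Y v :
  linear_subspace Y -> linear_subspace (extend_by Y v).
Proof.
move=> Ysub; have [Y0 Y1] := Ysub; split.
  by exists 0; rewrite scale0r subr0.
move=> c x y [a Ya] [b Yb]; exists (c * a + b).
rewrite (_ : _ - _ = c *: (x - a *: v) + (y - b *: v)); first exact: Y1.
by rewrite scalerBr scalerDl scalerA opprD addrACA.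
Qed.

Lemma finite_codim_cons n Y (v : 'I_n -> X) z :
  (forall x, exists c : 'I_n -> K,
     exists d : K, Y (x - \sum_(i < n) c i *: v i - d *: z)) ->
  finite_codim Y.
Proof.
move=> H; exists n.+1, (fun i => if unlift ord0 i is Some j then v j else z) => x.
have [c [d Yx]] := H x.
exists (fun i => if unlift ord0 i is Some j then c j else d).
rewrite big_ord_recl unlift_none.
rewrite (_ : _ - _ = x - \sum_(i < n) c i *: v i - d *: z) //.
rewrite opprD addrA addrAC; do 2 congr (_ - _).
by apply: eq_bigr => i _; rewrite liftK.
Qed.

(** Passing from Y + Kv to Y inside Z costs at most one more spanning vector: if
some z in Z lies in Y + Kv but not in Y, its v-coefficient c is nonzero, and
subtracting a multiple of z kills the v-component of any other vector of Z. *)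
Lemma finite_codim_extend_by Y Z v : linear_subspace Y -> linear_subspace Z ->
  finite_codim (extend_by Y v `&` Z) -> finite_codim (Y `&` Z).
Proof.
move=> Ysub Zsub [n [w wP]].
have [[z [[[c Yz] Zz] nYz]]|noz] :=
    pselect (exists z, (extend_by Y v `&` Z) z /\ ~ Y z); last first.
  exists n, w => x; have [c [Yx Zx]] := wP x; exists c; split => //.
  by apply: contrapT => nY; apply: noz; exists (x - \sum_(i < n) c i *: w i).
have c0 : c != 0.
  by apply: contra_notN nYz => /eqP c0; rewrite c0 scale0r subr0 in Yz.
apply: (@finite_codim_cons n _ w z) => x.
have [d [[e Yx] Zx]] := wP x; exists d, (e / c); split; last first.
  by rewrite addrC -scaleNr; apply: Zsub.2.
set u := x - _ in Yx *.
(* z - c v is in Y, so z and c v agree modulo Y and e v becomes (e / c) z. *)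
rewrite (_ : _ - _ = (- (e / c)) *: (z - c *: v) + (u - e *: v)); first exact: Ysub.2.
rewrite scalerBr scalerA mulNr divfK // (scaleNr e) opprK addrACA.
by rewrite subrr addr0 addrC scaleNr.
Qed.

(** The spanning vectors of X / Y are removed one at a time, each step enlarging Y
by the removed vector until Y is all of X. *)
Lemma finite_codimI Y Z : linear_subspace Y -> linear_subspace Z ->
  finite_codim Y -> finite_codim Z -> finite_codim (Y `&` Z).
Proof.
move=> Ysub Zsub [n [v vP]] Zfin; elim: n Y Ysub v vP => [|n IH] Y Ysub v vP.
  suff -> : Y `&` Z = Z by [].
  apply/seteqP; split => [x []//|x Zx]; split => //.
  by have [c] := vP x; rewrite big_ord0 subr0.
apply: (@finite_codim_extend_by _ _ (v ord0)) => //.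
apply: IH (subspace_extend_by _ Ysub) (fun i => v (lift ord0 i)) _ => x.
have [c] := vP x; rewrite big_ord_recl opprD addrA addrAC => Yx.
by exists (fun i => c (lift ord0 i)); exists (c ord0).
Qed.

Lemma cofinite_subspacesI Y Z : cofinite_subspaces Y -> cofinite_subspaces Z ->
  cofinite_subspaces (Y `&` Z).
Proof.
move=> [Y1 Y2 Y3] [Z1 Z2 Z3]; split; [exact: subspaceI|exact: closedI|].
exact: finite_codimI.
Qed.

Lemma cofinite_subspacesT : cofinite_subspaces [set: X].
Proof. by split => //; exists 0%N, (fun=> 0) => x; exists (fun=> 0). Qed.

(** This makes an asymptotic ultrafilter weakly null: each continuous functional
vanishes on one of its members. *)
Lemma cofinite_ker (f : {linear X -> K^o}) : continuous f ->
  cofinite_subspaces (f @^-1` [set 0]).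
Proof.
move=> fc; split.
- split; first by rewrite /= linear0.
  by move=> c u v /= fu fv; rewrite linearP fu fv scaler0 addr0.
- move/continuous_closedP: fc; apply.
  exact/accessible_closed_set1/hausdorff_accessible/norm_hausdorff.
- have [[v fv]|nov] := pselect (exists v, f v != 0).
    apply: (@finite_codim_cons 0 _ (fun=> 0) v) => x; exists (fun=> 0), (f x / f v).
    by rewrite big_ord0 subr0 /= linearB linearZ /= /GRing.scale/= divfK ?subrr.
  exists 0%N, (fun=> 0) => x; exists (fun=> 0); rewrite /= big_ord0 subr0.
  by apply: contrapT => /eqP fx; apply: nov; exists x.
Qed.

Lemma cofinite_sphere Y t : infinite_dimensional X -> cofinite_subspaces Y -> 0 <= t ->
  exists2 y, Y y & rnorm y = t.
Proof.
move=> Xinf [Ysub _ [n [v vP]]] t0.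
have [[y [Yy y0]]|noy] := pselect (exists y, Y y /\ rnorm y != 0).
  exists (real_scalar k (t / rnorm y) *: y); first exact: subspaceZ.
  by rewrite rnormZ ?divr_ge0 ?rnorm_ge0 // divfK.
exfalso; apply: Xinf; exists n, v => x; have [c Yx] := vP x; exists c.
apply/subr0_eq/rnorm0_eq0; apply: contrapT => /eqP x0; apply: noy.
by exists (x - \sum_(i < n) c i *: v i).
Qed.

End Cofinite.

(** * Filters as nets *)
Section FilterNets.
Local Open Scope classical_set_scope.
Set Implicit Arguments.
Unset Strict Implicit.
Variables (T : Type) (F : set_system T) (B : set T).
Hypotheses (FF : ProperFilter F) (FB : F B).

(** A filter F is turned into a net indexed by its members, each with a chosen
point and ordered by reverse inclusion. Only members inside B are used, so that
all the terms of the net, and not just a tail, lie in B: boundedness of nets is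
required at every index. *)
Definition pointed_member (p : T * set T) := [/\ F p.2, p.2 `<=` B & p.2 p.1].

Definition filter_net_index := {p | pointed_member p}.

Definition filter_net_le (a b : filter_net_index) := (sval b).2 `<=` (sval a).2.

Definition filter_net (a : filter_net_index) : T := (sval a).1.

Lemma filter_net_in a : B (filter_net a).
Proof. by have [_ aB ax] := svalP a; exact: aB. Qed.

Lemma filter_net_index_of U : F U ->
  exists a : filter_net_index, (sval a).2 `<=` U.
Proof.
move=> FU; have FUB : F (U `&` B) by exact: filterI.
have [x xUB] := filter_ex FUB.
have h : pointed_member (x, U `&` B).
  by split => //; exact: subIsetr.
by exists (exist _ _ h); exact: subIsetl.
Qed.

Lemma filter_net_le_refl a : filter_net_le a a. Proof. by []. Qed.

Lemma filter_net_le_trans a b c :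
  filter_net_le a b -> filter_net_le b c -> filter_net_le a c.
Proof. by move=> ab bc; exact: subset_trans bc ab. Qed.

Lemma filter_net_inh : exists a : filter_net_index, True.
Proof. by have [a _] := filter_net_index_of FB; exists a. Qed.

Lemma filter_net_ub a b : exists c, filter_net_le a c /\ filter_net_le b c.
Proof.
have [Fa _ _] := svalP a; have [Fb _ _] := svalP b.
have [c cab] := filter_net_index_of (filterI Fa Fb).
by exists c; split=> x /cab[].
Qed.

Definition filter_net_dir : directedSet := DirectedSet
  filter_net_le_refl filter_net_le_trans filter_net_inh filter_net_ub.

(** The net has exactly the convergence of F. *)
Lemma tails_filter_net (Q : set T) :
  tails filter_net_dir (filter_net @^-1` Q) <-> F Q.
Proof.
split=> [[a _ aQ]|FQ].
  have [Fa aB _] := svalP a; apply: filterS Fa => x ax.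
  have h : pointed_member (x, (sval a).2) by have [] := svalP a.
  exact: (aQ (exist _ _ h)).
have [a aQ] := filter_net_index_of FQ; exists a => // b ab.
by apply/aQ/ab; have [] := svalP b.
Qed.

Lemma cvg_filter_net (U : topologicalType) (f : T -> U) (l : U) :
  f @ F --> l -> f \o filter_net @ tails filter_net_dir --> l.
Proof. by move=> fl A /fl FA; apply/(tails_filter_net (f @^-1` A)). Qed.

Lemma net_limsup_filter_net (R : realType) (f : T -> R) (l : R) :
  f @ F --> l -> net_limsup (f \o filter_net : filter_net_dir -> R) = l%:E.
Proof.
move=> fl; apply/le_anti/andP; split.
  apply/lee_addgt0Pr => e e0.
  have Fe : F [set x | f x < l + e] by apply: (cvgr_lt l fl); rewrite ltrDl.
  have [a ae] := filter_net_index_of Fe.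
  apply: le_trans (ereal_inf_lbound _) _; first by exists a.
  apply: ge_ereal_sup => _ [b ab <-]; rewrite lee_fin ltW //.
  by apply/ae/ab; have [] := svalP b.
apply: le_ereal_inf_tmp => _ [a _ <-]; apply/lee_subgt0Pr => e e0.
have Fe : F [set x | l - e < f x] by apply: (cvgr_gt l fl); rewrite gtrBl.
have [Fa _ _] := svalP a.
have [b bae] := filter_net_index_of (filterI Fa Fe).
apply: (@le_trans _ _ (f (filter_net b))%:E).
  by rewrite -EFinB lee_fin ltW //; have [_ _ /bae[]] := svalP b.
by apply: ereal_sup_ubound; exists b => // x /bae[].
Qed.

End FilterNets.

(** * Limits along asymptotic ultrafilters *)
Section UltraLimits.
Local Open Scope classical_set_scope.
Set Implicit Arguments.
Unset Strict Implicit.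

Lemma ultra_bounded_cvg (R : realType) (T : Type) (F : set_system T) (f : T -> R)
    (a b : R) :
  UltraFilter F -> F [set x | a <= f x <= b] -> exists l : R, f @ F --> l.
Proof.
move=> FU Fab.
have Fi : F (f @^-1` `[a, b]) by apply: filterS Fab => x xab; rewrite /= in_itv.
(* An ultrafilter converges to each of its cluster points. *)
have [l [_ lf]] := segment_compact (fmap_proper_filter f _) Fi.
exists l => A Al.
have [//|FC] := in_ultra_setVsetC (f @^-1` A) FU.
by have [z []] := lf (~` A) A FC Al.
Qed.

End UltraLimits.

Section AsymptoticUltrafilters.
Local Open Scope classical_set_scope.
Set Implicit Arguments.
Unset Strict Implicit.
Variables (R : realType) (k : scalar_kind).
Local Notation K := (scalars R k).
Variable X : normedModType K.
Implicit Types (B Y : set X) (x y u : X) (V W : set_system X).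

Definition asymptotic_ultra B V :=
  [/\ UltraFilter V, V B & forall Y, cofinite_subspaces Y -> V Y].

Definition norm_bounded B := exists M : R, forall y, B y -> rnorm y <= M.

(** The intersections of B with the finite codimensional subspaces have the finite
intersection property, as these subspaces are stable under intersection. *)
Lemma asymptotic_ultra_exists B :
  (forall Y, cofinite_subspaces Y -> Y `&` B !=set0) ->
  exists V, asymptotic_ultra B V.
Proof.
move=> BY; pose F := filter_from (@cofinite_subspaces R k X) (fun Y => Y `&` B).
have FF : Filter F.
  apply: filter_from_filter; first by exists setT; exact: cofinite_subspacesT.
  move=> Y Z Yc Zc; exists (Y `&` Z); first exact: cofinite_subspacesI.
  by rewrite setIIl.
have FP : ProperFilter F by exact: filter_from_proper.
have [V [VU FV]] := ultraFilterLemma FP; exists V; split => //.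
  by apply: FV; exists setT; [exact: cofinite_subspacesT|exact: subIsetr].
by move=> Y Yc; apply: FV; exists Y => //; exact: subIsetl.
Qed.

Lemma asymptotic_cvg B V x : asymptotic_ultra B V -> norm_bounded B ->
  exists l : R, rnorm (x + y) @[y --> V] --> l.
Proof.
move=> [VU VB _] [M BM]; apply: (@ultra_bounded_cvg _ _ _ _ 0 (rnorm x + M)).
apply: filterS VB => y /BM yM /=; rewrite rnorm_ge0 /=.
by apply: le_trans (rnormD _ _) _; rewrite lerD2l.
Qed.

Section Net.
Variables (B : set X) (V : set_system X).
Hypotheses (VB : V B) (VF : ProperFilter V).

Lemma bounded_filter_net : norm_bounded B ->
  @bounded_net R k X (filter_net_dir VF VB) (@filter_net _ V B).
Proof. by move=> [M BM]; exists M => a; apply: BM; exact: (filter_net_in a). Qed.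

Lemma weakly_null_filter_net : (forall Y, cofinite_subspaces Y -> V Y) ->
  @weakly_null R k X (filter_net_dir VF VB) (@filter_net _ V B).
Proof.
move=> Vcof f fc; apply: cvg_filter_net => A /nbhs_singleton A0.
by apply: filterS (Vcof _ (cofinite_ker fc)) => x /= ->.
Qed.

End Net.

Lemma sM_limit_le B V x y (l m : R) : property_sM X ->
  asymptotic_ultra B V -> norm_bounded B -> rnorm y <= rnorm x ->
  rnorm (y + z) @[z --> V] --> m -> rnorm (x + z) @[z --> V] --> l -> m <= l.
Proof.
move=> sM [VU VB Vcof] Bb yx ym xl.
have VF : ProperFilter V by exact: ultra_proper.
have := sM x y yx _ _ (bounded_filter_net VB VF Bb)
  (weakly_null_filter_net VB VF Vcof).
rewrite -lee_fin -(net_limsup_filter_net VF VB ym).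
by rewrite -(net_limsup_filter_net VF VB xl).
Qed.

Lemma sM_limit_eq B V x y (l m : R) : property_sM X ->
  asymptotic_ultra B V -> norm_bounded B -> rnorm y = rnorm x ->
  rnorm (y + z) @[z --> V] --> m -> rnorm (x + z) @[z --> V] --> l -> m = l.
Proof.
move=> sM BV Bb yx ym xl; apply/le_anti/andP.
by split; [apply: (sM_limit_le sM BV Bb _ ym xl)|
           apply: (sM_limit_le sM BV Bb _ xl ym)]; rewrite yx.
Qed.

(** Weak lower semicontinuity of the norm, obtained from (sM): the limit is the
same at x and at -x. *)
Lemma rnorm_le_limit B V x (l : R) : property_sM X ->
  asymptotic_ultra B V -> norm_bounded B ->
  rnorm (x + z) @[z --> V] --> l -> rnorm x <= l.
Proof.
move=> sM BV Bb xl; have VU : UltraFilter V by case: BV.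
have [m xm] := asymptotic_cvg (- x) BV Bb.
have ml := sM_limit_eq sM BV Bb (rnormN x) xm xl; rewrite {m}ml in xm.
suff : rnorm x *+ 2 <= l + l by rewrite -mulr2n lerMn2r.
apply: cvgr_to_ge (cvgD xl xm) _.
by apply: nearW => z; exact: le_midpoint.
Qed.

Definition sphere t : set X := [set y | rnorm y = t].

Lemma norm_bounded_sphere t : norm_bounded (sphere t).
Proof. by exists t => y ->. Qed.

(** By (sM) the inner limits of both iterated limits of ||w + y|| are constant, so
these exist and equal l and m; weak net stability identifies them. *)
Lemma sphere_limits_eq s t V W x u (l m : R) :
  weak_net_stable X -> property_sM X ->
  asymptotic_ultra (sphere t) V -> asymptotic_ultra (sphere s) W ->
  rnorm x = s -> rnorm u = t ->
  rnorm (x + y) @[y --> V] --> l -> rnorm (u + w) @[w --> W] --> m -> l = m.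
Proof.
move=> stable sM.
have iter r V' x' (l' : R) (D : directedSet) (z : D -> X)
    (VF : ProperFilter V') (VB : V' (sphere r)) : asymptotic_ultra (sphere r) V' ->
    (forall a, rnorm (z a) = rnorm x') -> rnorm (x' + y) @[y --> V'] --> l' ->
    iterated_lim (A := D) (B := filter_net_dir VF VB)
      (fun a b => rnorm (z a + filter_net b)) l'.
  move=> V'B zx xl; exists (fun=> l'); split => [a|A /nbhs_singleton Al].
    apply: (@cvg_filter_net _ _ _ VF VB _ (fun y => rnorm (z a + y))).
    have [m' zm] := asymptotic_cvg (z a) V'B (norm_bounded_sphere r).
    by have <- := sM_limit_eq sM V'B (norm_bounded_sphere r) (zx a) zm xl.
  by have [a _] := dir_inh D; exists a.
move=> Vs Ws xs ut xl um.
have [VU VB Vcof] := Vs; have [WU WB Wcof] := Ws.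
have VF : ProperFilter V by exact: ultra_proper.
have WF : ProperFilter W by exact: ultra_proper.
apply: (stable (filter_net_dir WF WB) (filter_net_dir VF VB)
  (@filter_net _ W _) (@filter_net _ V _)).
- exact: (bounded_filter_net _ _ (@norm_bounded_sphere _)).
- exact: weakly_null_filter_net.
- exact: (bounded_filter_net _ _ (@norm_bounded_sphere _)).
- exact: weakly_null_filter_net.
- by apply: iter xl => // a; rewrite xs; exact: (filter_net_in a).
- rewrite (_ : (fun b a => _) = fun b a => rnorm (filter_net b + filter_net a)).
    by apply: iter um => // b; rewrite ut; exact: (filter_net_in b).
  by apply/funext => b; apply/funext => a; rewrite addrC.
Qed.

End AsymptoticUltrafilters.

(** * The two moduli *)
Section Moduli.
Local Open Scope classical_set_scope.
Set Implicit Arguments.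
Unset Strict Implicit.
Variables (R : realType) (k : scalar_kind).
Local Notation K := (scalars R k).
Variable X : normedModType K.
Hypotheses (Xinf : infinite_dimensional X) (stable : weak_net_stable X).
Hypothesis sM : property_sM X.
Variable t : R.
Hypothesis t_ge0 : 0 <= t.
Implicit Types (B Y : set X) (x y u : X) (V W : set_system X).

Lemma asymptotic_sphere_exists s :
  0 <= s -> exists V, asymptotic_ultra (@sphere R k X s) V.
Proof.
move=> s0; apply: asymptotic_ultra_exists => Y Yc.
by have [y Yy ys] := cofinite_sphere Xinf Yc s0; exists y.
Qed.

(** Comparing every pair (x, V) with one fixed pair (u, W), where W lives on the
unit sphere and u has norm t, removes the dependence on x and V. *)
Lemma common_limit : exists N : R,
  forall x V, rnorm x = 1 -> asymptotic_ultra (sphere t) V ->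
    rnorm (x + y) @[y --> V] --> N.
Proof.
have [W W1] := asymptotic_sphere_exists ler01.
have [u _ ut] := cofinite_sphere Xinf (@cofinite_subspacesT R k X) t_ge0.
have [N uN] := asymptotic_cvg u W1 (@norm_bounded_sphere R k X 1).
exists N => x V x1 Vt.
have [l xl] := asymptotic_cvg x Vt (@norm_bounded_sphere R k X t).
by have <- := sphere_limits_eq stable sM Vt W1 x1 ut xl uN.
Qed.

Section CommonLimit.
Variables (N : R) (x : X).
Hypothesis x1 : rnorm x = 1.
Hypothesis xN : forall V, asymptotic_ultra (sphere t) V ->
  rnorm (x + y) @[y --> V] --> N.

Lemma common_limit_ge1 : 1 <= N.
Proof.
have [V Vt] := asymptotic_sphere_exists t_ge0.
rewrite -x1; exact: (rnorm_le_limit sM Vt (@norm_bounded_sphere R k X t) (xN Vt)).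
Qed.

Lemma sphere_near_common_limit Y e : cofinite_subspaces Y -> 0 < e ->
  exists y, [/\ Y y, rnorm y = t & N - e < rnorm (x + y) < N + e].
Proof.
move=> Yc e0; have [V Vt] := asymptotic_sphere_exists t_ge0.
have [VU VB Vcof] := Vt; have VN := xN Vt.
have VF : ProperFilter V by exact: ultra_proper.
have Vlt : V [set y | rnorm (x + y) < N + e] by apply: (cvgr_lt N VN); rewrite ltrDl.
have Vgt : V [set y | N - e < rnorm (x + y)] by apply: (cvgr_gt N VN); rewrite gtrBl.
have [y [[ylt ygt] [Yy yt]]] :=
  filter_ex (filterI (filterI Vlt Vgt) (filterI (Vcof _ Yc) VB)).
by exists y; split=> //; apply/andP.
Qed.

Lemma sphere_family_le_common_limit (c : R) :
  (forall Y, cofinite_subspaces Y ->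
    exists y, [/\ Y y, rnorm y = t & c <= rnorm (x + y)]) -> c <= N.
Proof.
move=> H; pose B := [set y | rnorm y = t /\ c <= rnorm (x + y)].
have [Y Yc|V [VU VB Vcof]] := @asymptotic_ultra_exists _ _ X B.
  by have [y [Yy yt cy]] := H _ Yc; exists y.
have VF : ProperFilter V by exact: ultra_proper.
have Vt : asymptotic_ultra (sphere t) V.
  by split => //; apply: filterS VB => y [].
by apply: cvgr_to_ge (xN Vt) _; apply: filterS VB => y [].
Qed.

Lemma sphere_family_ge_common_limit (c : R) :
  (forall Y, cofinite_subspaces Y ->
    exists y, [/\ Y y, rnorm y = t & rnorm (x + y) <= c]) -> N <= c.
Proof.
move=> H; pose B := [set y | rnorm y = t /\ rnorm (x + y) <= c].
have [Y Yc|V [VU VB Vcof]] := @asymptotic_ultra_exists _ _ X B.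
  by have [y [Yy yt cy]] := H _ Yc; exists y.
have VF : ProperFilter V by exact: ultra_proper.
have Vt : asymptotic_ultra (sphere t) V.
  by split => //; apply: filterS VB => y [].
by apply: cvgr_to_le (xN Vt) _; apply: filterS VB => y [].
Qed.

(** The bound c itself makes the chosen vectors bounded, so lower semicontinuity
applies although no bound on y is assumed. *)
Lemma weakly_null_family_ge1 (c : R) :
  (forall Y, cofinite_subspaces Y -> exists2 y, Y y & rnorm (x + y) <= c) ->
  1 <= c.
Proof.
move=> H; pose B := [set y | rnorm (x + y) <= c].
have [Y Yc|V VB] := @asymptotic_ultra_exists _ _ X B.
  by have [y Yy cy] := H _ Yc; exists y.
have Bb : norm_bounded B.
  exists (c + 1) => y By; rewrite -[y](addKr x) addrC -x1 -(rnormN x).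
  by apply: le_trans (rnormD _ _) _; rewrite lerD2r.
have [l xl] := asymptotic_cvg x VB Bb.
have [VU VB' _] := VB; have VF : ProperFilter V by exact: ultra_proper.
apply: (@le_trans _ _ l); first by rewrite -x1; exact: (rnorm_le_limit sM VB Bb xl).
exact: cvgr_to_le xl VB'.
Qed.

(** Shrinking y to norm t stays below c: by convexity ||x + sy|| is at most
(1 - s) + s c, and c >= 1. *)
Lemma outside_family_ge_common_limit (c : R) :
  (forall Y, cofinite_subspaces Y ->
    exists y, [/\ Y y, t <= rnorm y & rnorm (x + y) <= c]) -> N <= c.
Proof.
move=> H; have c1 : 1 <= c.
  by apply: weakly_null_family_ge1 => Y /H[y [Yy _ yc]]; exists y.
apply: sphere_family_ge_common_limit => Y Yc; have [y [Yy ty yc]] := H _ Yc.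
have s0 : 0 <= t / rnorm y by rewrite divr_ge0 ?rnorm_ge0.
have s1 : t / rnorm y <= 1.
  have [->|y0] := eqVneq (rnorm y) 0; first by rewrite invr0 mulr0.
  by rewrite ler_pdivrMr ?mul1r // lt0r y0 rnorm_ge0.
(* If y = 0 then t = 0, and the division by zero yields the vector 0. *)
exists (real_scalar k (t / rnorm y) *: y); split.
- by case: Yc => Ysub _ _; exact: subspaceZ.
- rewrite rnormZ //; have [y0|y0] := eqVneq (rnorm y) 0; last by rewrite divfK.
  by rewrite y0 mulr0; apply/le_anti; rewrite t_ge0 -y0 ty.
- apply: (@le_trans _ _ ((1 - t / rnorm y) * rnorm x + t / rnorm y * rnorm (x + y))).
    by apply: rnorm_convex; rewrite s0.
  by rewrite x1; move: (t / _) s0 s1 => s s0 s1; nra.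
Qed.

(** Dual to the previous lemma: for c > 1, stretching y to norm t stays above c,
since y lies on the segment from 0 to the stretched vector. *)
Lemma inside_family_le_common_limit (c : R) :
  (forall Y, cofinite_subspaces Y ->
    exists y, [/\ Y y, rnorm y <= t & c <= rnorm (x + y)]) -> c <= N.
Proof.
move=> H; have [c1|c1] := leP c 1; first exact: le_trans c1 common_limit_ge1.
apply: sphere_family_le_common_limit => Y Yc; have [y [Yy yt yc]] := H _ Yc.
(* y = 0 would give ||x + y|| = 1 < c. *)
have y0 : 0 < rnorm y.
  rewrite lt0r rnorm_ge0 andbT; apply: contraL c1 => /eqP/rnorm0_eq0 y0.
  by rewrite -leNgt -x1 -(addr0 x) -y0.
have t0 : 0 < t by exact: lt_le_trans yt.
have ts : 0 <= t / rnorm y by rewrite divr_ge0 ?rnorm_ge0.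
exists (real_scalar k (t / rnorm y) *: y); split.
- by case: Yc => Ysub _ _; exact: subspaceZ.
- by rewrite rnormZ // divfK // gt_eqF.
set y' := _ *: y.
have yE : y = real_scalar k (rnorm y / t) *: y'.
  rewrite /y' scalerA -real_scalarM mulrA divfK ?gt_eqF // divff ?gt_eqF //.
  by rewrite real_scalar1 scale1r.
have s1 : rnorm y / t <= 1 by rewrite ler_pdivrMr ?mul1r.
have s0 : 0 < rnorm y / t by rewrite divr_gt0.
have : c <= (1 - rnorm y / t) * rnorm x + rnorm y / t * rnorm (x + y').
  by apply: (le_trans yc); rewrite {1}yE; apply: rnorm_convex; rewrite ltW.
by rewrite x1; move: (rnorm y / t) (rnorm (x + y')) s0 s1 => s r s0 s1 cs; nra.
Qed.

Lemma auc_modulus_at_common_limit : auc_modulus_at x t = (N - 1)%:E.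
Proof.
rewrite /auc_modulus_at EFinB; congr (_ - _)%E; apply/le_anti/andP; split.
  apply: ge_ereal_sup => _ [Y Yc <-]; apply/lee_addgt0Pr => e e0.
  have [y [Yy yt /andP[_ ye]]] := sphere_near_common_limit Yc e0.
  apply: (@le_trans _ _ (rnorm (x + y))%:E); last by rewrite -EFinD lee_fin ltW.
  by apply: ereal_inf_lbound; exists y => //; split => //=; rewrite yt.
apply/lee_subgt0Pr => e e0; rewrite leNgt; apply/negP => supN.
suff : N <= N - e by rewrite leNgt gtrBl e0.
apply: outside_family_ge_common_limit => Y Yc.
have /ereal_inf_lt[_ [y [Yy ty] <-]] := le_lt_trans
  (ereal_sup_ubound (ex_intro2 _ _ Y Yc erefl)) supN.
by rewrite -EFinB lte_fin => /ltW; exists y.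
Qed.

Lemma aus_modulus_at_common_limit : aus_modulus_at x t = (N - 1)%:E.
Proof.
rewrite /aus_modulus_at EFinB; congr (_ - _)%E; apply/le_anti/andP; split.
  apply/lee_addgt0Pr => e e0; rewrite leNgt; apply/negP => infN.
  suff : N + e <= N by rewrite leNgt ltrDl e0.
  apply: inside_family_le_common_limit => Y Yc.
  have /ereal_sup_gt[_ [y [Yy ty] <-]] := lt_le_trans infN
    (ereal_inf_lbound (ex_intro2 _ _ Y Yc erefl)).
  by rewrite -EFinD lte_fin => /ltW; exists y.
apply: le_ereal_inf_tmp => _ [Y Yc <-]; apply/lee_subgt0Pr => e e0.
have [y [Yy yt /andP[ye _]]] := sphere_near_common_limit Yc e0.
apply: (@le_trans _ _ (rnorm (x + y))%:E); first by rewrite -EFinB lee_fin ltW.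
by apply: ereal_sup_ubound; exists y => //; split => //=; rewrite yt.
Qed.

End CommonLimit.

Lemma auc_eq_aus : auc_modulus X t = aus_modulus X t.
Proof.
have [N xN] := common_limit.
have [x _ x1] := cofinite_sphere Xinf (@cofinite_subspacesT R k X) ler01.
have auc y : unit_sphere y -> auc_modulus_at y t = (N - 1)%:E.
  by move=> y1; apply: auc_modulus_at_common_limit => // V; exact: xN.
have aus y : unit_sphere y -> aus_modulus_at y t = (N - 1)%:E.
  by move=> y1; apply: aus_modulus_at_common_limit => // V; exact: xN.
transitivity (N - 1)%:E; apply/le_anti/andP; split.
- by rewrite -(auc x x1); apply: ereal_inf_lbound; exists x.
- by apply: le_ereal_inf_tmp => _ [y y1 <-]; rewrite auc.
- by rewrite -(aus x x1); apply: ereal_sup_ubound; exists x.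
- by apply: ge_ereal_sup => _ [y y1 <-]; rewrite aus.
Qed.

End Moduli.

Theorem theorem5p8 (R : realType) (k : scalar_kind) :
  (forall X : completeNormedModType (scalars R k),
     infinite_dimensional X -> weak_net_stable X -> property_sM X ->
     forall t : R, 0 <= t -> auc_modulus X t = aus_modulus X t)
  /\
  (forall X : completeNormedModType (scalars R k),
     infinite_dimensional X -> net_stable X -> property_sM X ->
     forall t : R, 0 <= t -> auc_modulus X t = aus_modulus X t).
Proof.
split=> X Xinf stable sM t t0; apply: auc_eq_aus => //.
by move=> A B x y xb _ yb _; exact: stable.
Qed.
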